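(* Suppose $0<r<p<\infty$. Then there is a constant $c=c(r,p)$, depending only on $r$ and $p$, such that whenever $X$ is a quasi-Banach function space (on some compact Hausdorff space $\Omega$) satisfying an upper $p$-estimate and a lower $q$-estimate, where $q/p=1+\theta$ with $0<\theta<1$, we have $$\log M^{(r)}(X)\le\theta\Bigl(c+\frac1p|\log\theta|\Bigr).$$
   Context: Let $\Omega$ be a compact Hausdorff space and $B(\Omega)$ the space of all real-valued Borel functions on $\Omega$. An admissible extended-value quasinorm on $B(\Omega)$ is a map $f\mapsto\|f\|_X$, $B(\Omega)\to[0,\infty]$, such that: (a) $\|f\|_X\le\|g\|_X$ whenever $|f|\le|g|$ pointwise; (b) $\|\alpha f\|_X=|\alpha|\|f\|_X$ for $\alpha\in\mathbb R$; (c) there is a constant $C$ with $\|f+g\|_X\le C(\|f\|_X+\|g\|_X)$ whenever $f,g\ge0$ have disjoint supports; (d) there exists a strictly positive $u\in B(\Omega)$ with $0<\|u\|_X<\infty$; (e) if $f_n\ge0$ and $f_n\uparrow f$ pointwise (with $f\in B(\Omega)$) then $\|f_n\|_X\to\|f\|_X$. The space $X=\{f\in B(\Omega):\|f\|_X<\infty\}$ with $\|\cdot\|_X$ (identifying $f,g$ with $\|f-g\|_X=0$) is called a quasi-Banach function space on $\Omega$. $X$ satisfies an upper $p$-estimate if $\|f_1+\cdots+f_n\|_X\le(\sum_{i=1}^n\|f_i\|_X^p)^{1/p}$ for all disjointly supported $f_1,\dots,f_n\in X$; it satisfies a lower $q$-estimate if $\|f_1+\cdots+f_n\|_X\ge(\sum_{i=1}^n\|f_i\|_X^q)^{1/q}$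 for all disjointly supported $f_1,\dots,f_n\in X$ (both with constant one). For $0<r<\infty$, $M^{(r)}(X)$ is the least constant $M\in[0,\infty]$ such that $\bigl\|(\sum_{i=1}^n|f_i|^r)^{1/r}\bigr\|_X\le M(\sum_{i=1}^n\|f_i\|_X^r)^{1/r}$ for all $n$ and all $f_1,\dots,f_n\in X$. *)

(* Defs.v *)
From HB Require Import structures.
From mathcomp Require Import all_boot all_order all_algebra.
From mathcomp Require Import all_classical all_reals all_analysis.

Set Implicit Arguments.
Unset Strict Implicit.
Unset Printing Implicit Defensive.

Import Order.TTheory GRing.Theory Num.Theory.
Import numFieldNormedType.Exports.

Local Open Scope classical_set_scope.
Local Open Scope ring_scope.

(* Stated with <<s open>> since the measurableType structure on
   g_sigma_algebraType, hence measurable_fun, requires a pointed type. *)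
Definition borel_fun (R : realType) (Omega : topologicalType)
    (f : Omega -> R) : Prop :=
  forall B : set R, measurable B -> <<s @open Omega >> (f @^-1` B).

Lemma borel_funE (R : realType) (Omega : ptopologicalType) (f : Omega -> R) :
  borel_fun f <->
  measurable_fun [set: g_sigma_algebraType (@open Omega)]
    (f : g_sigma_algebraType (@open Omega) -> R).
Proof.
split=> [bf _ B mB|mf B mB]; first by rewrite setTI; exact: bf.
by rewrite -[_ @^-1` _]setTI; apply: mf => //; exact: measurableT.
Qed.

(* The set where f does not vanish, without taking a topological closure. *)
Definition supp (R : realType) (T : Type) (f : T -> R) : set T :=
  f @^-1` [set~ 0].

(* B(Omega) is modelled by the predicate borel_fun on Omega -> R; the values of
   N outside B(Omega) are never used. In aq_homog, \bar R sets 0 * +oo = 0. *)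
Record admissible_quasinorm (R : realType) (Omega : topologicalType)
    (N : (Omega -> R) -> \bar R) : Prop := AdmissibleQuasinorm {
  aq_ge0 : forall f, borel_fun f -> (0 <= N f)%E ;
  aq_mono : forall f g, borel_fun f -> borel_fun g ->
    (forall x, `|f x| <= `|g x|) -> (N f <= N g)%E ;
  aq_homog : forall (a : R) f, borel_fun f ->
    N (fun x => a * f x) = (`|a|%:E * N f)%E ;
  aq_quasi_triangle : exists C : R, forall f g : Omega -> R,
    borel_fun f -> borel_fun g ->
    (forall x, 0 <= f x) -> (forall x, 0 <= g x) ->
    supp f `&` supp g = set0 ->
    (N (fun x => (f x + g x)%R) <= C%:E * (N f + N g))%E ;
  aq_weak_unit : exists u : Omega -> R, [/\ borel_fun u, forall x, 0 < u x,
    (0 < N u)%E & (N u < +oo)%E] ;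
  aq_monotone_cvg : forall (f_ : nat -> Omega -> R) (f : Omega -> R),
    (forall n, borel_fun (f_ n)) -> borel_fun f ->
    (forall n x, 0 <= f_ n x) ->
    (forall x, nondecreasing_seq (fun n => f_ n x)) ->
    (forall x, f_ n x @[n --> \oo] --> f x) ->
    N (f_ n) @[n --> \oo] --> N f
}.

(* Members of X are represented by functions rather than by classes modulo
   qnorm (f - g) = 0. Under an upper p-estimate with constant one, qnorm
   depends only on the class, and functions whose classes are disjoint have
   disjointly supported representatives. *)
Record qBanach_function_space (R : realType) (Omega : topologicalType) :=
  QBanachFunctionSpace {
    qnorm : (Omega -> R) -> \bar R ;
    qnorm_admissible : admissible_quasinorm qnorm
  }.

Definition in_space (R : realType) (Omega : topologicalType)
    (X : qBanach_function_space R Omega) (f : Omega -> R) : Prop :=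
  borel_fun f /\ (qnorm X f < +oo)%E.

Definition upper_estimate (R : realType) (Omega : topologicalType)
    (X : qBanach_function_space R Omega) (p : R) : Prop :=
  forall (n : nat) (f : 'I_n -> Omega -> R),
    (forall i, in_space X (f i)) ->
    trivIset [set: 'I_n] (fun i => supp (f i)) ->
    (qnorm X (fun x => (\sum_(i < n) f i x)%R) <=
      (\sum_(i < n) qnorm X (f i) `^ p) `^ p^-1)%E.

Definition lower_estimate (R : realType) (Omega : topologicalType)
    (X : qBanach_function_space R Omega) (q : R) : Prop :=
  forall (n : nat) (f : 'I_n -> Omega -> R),
    (forall i, in_space X (f i)) ->
    trivIset [set: 'I_n] (fun i => supp (f i)) ->
    ((\sum_(i < n) qnorm X (f i) `^ q) `^ q^-1 <=
      qnorm X (fun x => (\sum_(i < n) f i x)%R))%E.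

Definition convex_with (R : realType) (Omega : topologicalType)
    (X : qBanach_function_space R Omega) (r : R) (M : \bar R) : Prop :=
  forall (n : nat) (f : 'I_n -> Omega -> R),
    (forall i, in_space X (f i)) ->
    (qnorm X (fun x => ((\sum_(i < n) `|f i x| `^ r) `^ r^-1)%R) <=
      M * (\sum_(i < n) qnorm X (f i) `^ r) `^ r^-1)%E.

(* The infimum is attained: convex_with X r is a closed condition on M, and it
   holds at M = +oo. *)
Definition convexity_constant (R : realType) (Omega : topologicalType)
    (X : qBanach_function_space R Omega) (r : R) : \bar R :=
  ereal_inf [set M : \bar R | (0 <= M)%E /\ convex_with X r M].

(* Main.v *)
Require Import Defs.
From HB Require Import structures.
From mathcomp Require Import all_boot all_order all_algebra.
From mathcomp Require Import all_classical all_reals all_analysis.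
From mathcomp Require Import measurable_realfun ring lra.
Import Order.TTheory GRing.Theory Num.Theory.
Import numFieldNormedType.Exports.

Set Implicit Arguments.
Unset Strict Implicit.

Local Open Scope classical_set_scope.
Local Open Scope ring_scope.

(** Write s = p / r > 1 and Q = q / p = 1 + theta, and let P be the function
    (sum_i |f_i|^r)^(1/r). The set function phi(A) = ||P 1_A||^p is monotone
    and subadditive, and it is almost superadditive: on disjoint pieces the
    sum of the phi^Q is at most phi^Q of the union. The estimate rests on two
    facts, each of which costs a factor 1 + O(theta), apart from one Hölder
    inequality that costs theta^(-theta/(1+theta)).

    The first fact is about covers. If weighted sets cover the space at least
    once, then phi of the whole space is at most Q^2 times the total cost
    sum_B c_B phi(B) (fractional_cover_bound). Take a cover c of minimal cost
    S and total mass W, and delete from the space, again and again, a random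
    set B drawn with probability c_B / W. After j steps each point survives
    with probability at most s_j = (1 - 1/W)^j. One more step lowers phi by at
    most the average of phi(A :&: B), where A is the current residue. The lower
    estimate bounds phi(A :&: B) by an expression that decreases linearly in
    phi(B :\: A) (lower_split_bound), and minimality of c bounds the mean of
    sum_B c_B phi(B :\: A) from below by (1 - s_j) S, because the random sets
    B :\: A cover the space 1 - s_j times. So the step costs at most
    Q S s_j^(1/Q) / W, and the geometric series adds up to at most Q^2 S.

    The second fact produces a cheap cover out of the f_i. Let beta_i be
    ||f_i||^r or slightly more, Z = sum_i beta_i, and put z_i = Z |f_i|^r /
    (beta_i P^r), so that the convex combination of the z_i with weights
    beta_i / Z is 1 at each point. Since Bernoulli's tangent 1 + s (z - 1) is
    affine and has value 1 at z = 1, the weights (beta_i / Z) times the positive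
    part of the tangent at z_i cover every point where P is nonzero. Cutting at
    the levels z_k = z_0 e^(theta k) makes this a fractional cover by sets E_ik.
    The lower estimate applied to the pieces of f_i on the E_ik bounds an l_Q
    norm of the numbers phi(E_ik); by duality the cost of the cover is
    controlled by the l_Q' norm, Q' = Q / theta, of the ratios tangent(z) / z^s over the levels.
    These ratios are at most 1 by Bernoulli and decay like z^(1-s), so the
    sum of their Q'-th powers is O(1/theta) and the norm is
    O(1/theta)^(theta/(1+theta)) (holder_levels).

    Altogether ||P||^p is at most power_bound s theta times Z^s, and the
    logarithm of the (1/p)-th power of power_bound is the bound claimed
    (ln_power_bound). *)

(** * Power inequalities *)

Section PowerInequalities.
Context {R : realType}.
Implicit Types a b s u v w x y theta Q : R.

(** Young's inequality with exponents Q = 1 + theta and Q / theta, cleared of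
    denominators. Bernoulli's inequality is the case y = 1. *)
Lemma weighted_young x y theta : 0 < theta -> 0 <= x -> 0 <= y ->
  (1 + theta) * (x * y `^ theta) <= x `^ (1 + theta) + theta * y `^ (1 + theta).
Proof.
move=> t0 x0 y0; set Q := 1 + theta.
have Q0 : 0 < Q by rewrite /Q; lra.
have tQ : Q != 0 by rewrite gt_eqF.
have t0' : theta != 0 by rewrite gt_eqF.
have conj : Q^-1 + (Q / theta)^-1 = 1.
  by rewrite invf_div -{1}(mul1r Q^-1) -mulrDl divff.
have := conjugate_powR x0 (powR_ge0 y theta) Q0 (divr_gt0 Q0 t0) conj.
rewrite -powRrM (_ : theta * (Q / theta) = Q) => [H|]; last by field.
rewrite -(ler_pM2l Q0) in H; apply: (le_trans H).
by rewrite le_eqVlt; apply/orP; left; apply/eqP; field; rewrite tQ t0'.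
Qed.

Lemma powR_bernoulli x s : 1 < s -> 0 <= x -> 1 + s * (x - 1) <= x `^ s.
Proof.
move=> s1 x0; have t0 : 0 < s - 1 by lra.
have := weighted_young t0 x0 ler01.
by rewrite !powR1 !mulr1 [1 + (s - 1)]addrC subrK; lra.
Qed.

Lemma powR_inv_bernoulli x Q : 1 < Q -> 0 <= x ->
  x `^ Q^-1 <= 1 - (1 - x) / Q.
Proof.
move=> Q1 x0; have Q0 : 0 < Q by lra.
have := powR_bernoulli Q1 (powR_ge0 x Q^-1).
rewrite -powRrM mulVf ?gt_eqF // powRr1 // => H.
rewrite -(ler_pM2l Q0) mulrBr mulrCA divff ?gt_eqF //; lra.
Qed.

Lemma ler_powR2r a b s : 0 < s -> 0 <= a -> 0 <= b ->
  (a `^ s <= b `^ s) = (a <= b).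
Proof.
move=> s0 a0 b0; apply/idP/idP => [|ab]; last first.
  by apply: ge0_ler_powR; rewrite ?nnegrE // ltW.
by apply: contraTT; rewrite -!ltNge => ba; apply: gt0_ltr_powR.
Qed.

(** The constraint v^Q + u^Q <= w^Q, with Q = 1 + theta, gives
    v^Q <= Q w^theta (w - u) by convexity of the power, and Young's inequality then makes the bound on
    v affine in u and w. The free
    parameter s selects the tangent line; it is later the survival probability
    of a point. An affine bound is what survives averaging. *)
Lemma lower_split_bound theta s u v w : 0 < theta -> 0 < s ->
  0 <= u -> 0 <= v -> 0 <= w ->
  v `^ (1 + theta) + u `^ (1 + theta) <= w `^ (1 + theta) ->
  v <= s `^ (1 + theta)^-1 * ((w - u) / s + theta * w).
Proof.
move=> t0 s0 u0 v0 w0 low; set Q := 1 + theta in low *.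
have Q0 : 0 < Q by rewrite /Q; lra.
have Qn : Q != 0 by rewrite gt_eqF.
have uw : u <= w.
  by rewrite -(ler_powR2r Q0) //; apply: le_trans low; rewrite lerDr powR_ge0.
set x := (w - u) / s; have x0 : 0 <= x by rewrite divr_ge0 ?subr_ge0 // ltW.
set tau := s `^ Q^-1; have tau0 : 0 <= tau by exact: powR_ge0.
have tauQ : tau `^ Q = s by rewrite /tau -powRrM mulVf // powRr1 // ltW.
have wQ : w `^ Q = w * w `^ theta.
  by have := mulr_powRB1 w0 Q0; rewrite /Q addrC addKr => <-.
have vQ : v `^ Q <= Q * (s * x * w `^ theta).
  have Yu := weighted_young t0 u0 w0.
  rewrite -/Q wQ in Yu; rewrite wQ in low.
  have -> : s * x = w - u by rewrite /x mulrC divfK ?gt_eqF.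
  by move: low Yu; rewrite /Q; set a := v `^ _; set b := u `^ _; nra.
have xw0 : 0 <= x + theta * w by rewrite addr_ge0 // mulr_ge0 // ltW.
rewrite -(ler_powR2r Q0) ?mulr_ge0 //.
rewrite powRM // tauQ; apply: (le_trans vQ).
rewrite -mulrA mulrCA ler_pM2l //.
have Yw := weighted_young t0 xw0 w0.
rewrite -/Q wQ in Yw.
have : 0 <= theta * theta * (w * w `^ theta).
  by rewrite !mulr_ge0 ?powR_ge0 // ltW.
rewrite /Q in Yw *; move: Yw; set e := _ `^ (1 + theta).
by set d := w `^ theta; nra.
Qed.
End PowerInequalities.

(** * Residues of random deletions and the minimal fractional cover *)

Section ResidueLaw.
Context {R : realType} {T : finType} (d : {set T} -> R).
Implicit Types (A B : {set T}) (G H : {set T} -> R).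

(** Law after j steps of the residue of the full set, when a random set
    drawn from the weights d is deleted at each step. *)
Fixpoint residue_law (j : nat) : {set T} -> R :=
  if j is k.+1 then fun A' => \sum_(A : {set T}) \sum_(B : {set T})
    residue_law k A * d B * (A :\: B == A')%:R
  else fun A => (A == [set: T]%SET)%:R.

Definition residue_mean j G : R := \sum_(A : {set T}) residue_law j A * G A.

Lemma sum_push_set (I : finType) (g : I -> {set T}) (m : I -> R) G :
  \sum_(A : {set T}) (\sum_i m i * (g i == A)%:R) * G A = \sum_i m i * G (g i).
Proof.
under eq_bigr do rewrite mulr_suml.
rewrite exchange_big /=; apply: eq_bigr => i _.
rewrite (bigD1 (g i)) //= eqxx mulr1 big1 ?addr0 // => A /negbTE Ag.
by rewrite eq_sym Ag mulr0 mul0r.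
Qed.

Lemma residue_mean0 G : residue_mean 0 G = G [set: T]%SET.
Proof.
rewrite /residue_mean (bigD1 [set: T]%SET) //= eqxx mul1r big1 ?addr0 // => A.
by move=> /negbTE ->; rewrite mul0r.
Qed.

Lemma residue_meanS j G : residue_mean j.+1 G =
  residue_mean j (fun A => \sum_(B : {set T}) d B * G (A :\: B)).
Proof.
rewrite /residue_mean /=.
under eq_bigr => A' _ do rewrite pair_bigA /=.
rewrite (sum_push_set (fun i : {set T} * {set T} => i.1 :\: i.2)
  (fun i => residue_law j i.1 * d i.2)).
rewrite -(pair_bigA _ (fun A B => residue_law j A * d B * G (A :\: B))) /=.
apply: eq_bigr => A _; rewrite mulr_sumr; apply: eq_bigr => B _.
by rewrite mulrA.
Qed.

Hypothesis d_ge0 : forall B, 0 <= d B.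

Lemma residue_law_ge0 j A : 0 <= residue_law j A.
Proof.
elim: j A => [|j IH] A /=; first by rewrite ler0n.
by apply: sumr_ge0 => B _; apply: sumr_ge0 => C _; rewrite !mulr_ge0.
Qed.

Lemma le_residue_mean j G H : (forall A, G A <= H A) ->
  residue_mean j G <= residue_mean j H.
Proof.
by move=> GH; apply: ler_sum => A _; rewrite ler_wpM2l ?residue_law_ge0.
Qed.

Lemma residue_meanD j G H :
  residue_mean j (fun A => G A + H A) = residue_mean j G + residue_mean j H.
Proof. by rewrite -big_split; apply: eq_bigr => A _; rewrite mulrDr. Qed.

Lemma residue_meanZ j a G :
  residue_mean j (fun A => a * G A) = a * residue_mean j G.
Proof.
by rewrite mulr_sumr; apply: eq_bigr => A _; rewrite mulrCA.
Qed.

Lemma residue_mean_const j a : \sum_(B : {set T}) d B = 1 ->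
  residue_mean j (fun=> a) = a.
Proof.
move=> d1; elim: j => [|j IH]; first by rewrite residue_mean0.
by rewrite residue_meanS -mulr_suml d1 mul1r.
Qed.

Lemma residue_mean_mem j t sigma : 0 <= sigma ->
  \sum_(B : {set T}) d B * (t \notin B)%:R <= sigma ->
  residue_mean j (fun A => (t \in A)%:R) <= sigma ^+ j.
Proof.
move=> s0 ds; elim: j => [|j IH]; first by rewrite residue_mean0 finset.in_setT.
rewrite residue_meanS exprS.
apply: le_trans (_ : residue_mean j (fun A => sigma * (t \in A)%:R) <= _).
  apply: le_residue_mean => A.
  under eq_bigr => B _ do rewrite finset.in_setD -mulnb natrM mulrA.
  by rewrite -mulr_suml ler_wpM2r.
by rewrite residue_meanZ ler_wpM2l.
Qed.

End ResidueLaw.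

Section FractionalCover.
Context {R : realType} {T : finType}.
Implicit Types (A B : {set T}) (c w : {set T} -> R).

Definition fractional_cover (lambda : R) c : Prop :=
  (forall B, 0 <= c B) /\
  (forall t, lambda <= \sum_(B : {set T}) c B * (t \in B)%:R).

Context (phi : {set T} -> R) (theta : R).
Hypotheses (theta_gt0 : 0 < theta) (phi_ge0 : forall A, 0 <= phi A).
Hypothesis phi_mono : forall A B, A \subset B -> phi A <= phi B.
Hypothesis phi_sub : forall A B, phi A <= phi (A :\: B) + phi (A :&: B).
Hypothesis phi_low : forall A B,
  phi (A :&: B) `^ (1 + theta) + phi (A :\: B) `^ (1 + theta)
    <= phi A `^ (1 + theta).

Definition cover_cost c : R := \sum_(B : {set T}) c B * phi B.

Let Q := 1 + theta.

Lemma phi_set0 : phi finset.set0 = 0.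
Proof.
have := phi_low finset.set0 finset.set0.
rewrite finset.setI0 finset.setD0 => H.
apply/eqP; rewrite -(@powR_eq0_eq0 _ (phi finset.set0) Q) //.
by apply/eqP; rewrite eq_le powR_ge0 andbT; move: H; rewrite -/Q; lra.
Qed.

Section Minimal.
Context (c : {set T} -> R).
Hypothesis c_cover : fractional_cover 1 c.
Hypothesis c_min : forall lambda w, 0 <= lambda -> fractional_cover lambda w ->
  lambda * cover_cost c <= cover_cost w.
Hypothesis c_mass : 1 < \sum_(B : {set T}) c B.

Let W := \sum_(B : {set T}) c B.
Let d B := c B / W.
Let sigma := 1 - W^-1.

Let W_gt0 : 0 < W. Proof. exact: lt_trans c_mass. Qed.
Let d_ge0 B : 0 <= d B. Proof. by rewrite divr_ge0 ?(ltW W_gt0)//; case: c_cover. Qed.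
Let d_sum1 : \sum_(B : {set T}) d B = 1.
Proof. by rewrite -mulr_suml divff ?gt_eqF. Qed.
Let sigma_gt0 : 0 < sigma.
Proof. by rewrite subr_gt0 invf_lt1. Qed.
Let sigma_lt1 : sigma < 1.
Proof. by rewrite gtrBl invr_gt0. Qed.

Lemma residue_mem_small j t :
  residue_mean d j (fun A => (t \in A)%:R) <= sigma ^+ j.
Proof.
apply: residue_mean_mem => //; first exact: ltW.
rewrite (_ : \sum_B _ = 1 - W^-1 * \sum_(B : {set T}) c B * (t \in B)%:R).
  by rewrite lerD2l lerN2 ler_peMr ?invr_ge0 ?(ltW W_gt0) //; case: c_cover.
rewrite -[X in X - _]d_sum1 mulr_sumr -sumrB; apply: eq_bigr => B _.
by rewrite /d; case: (t \in B); rewrite /= ?mulr1 ?mulr0 ?subr0 // mulrC subrr.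
Qed.

(** The sets B :\: A, with A distributed as the residue and B weighted by c,
    form a cover of multiplicity 1 - sigma^j: each point is covered once by c
    and is missing from the residue with probability at least 1 - sigma^j. The
    minimality of c then bounds their cost from below. *)
Lemma residue_removed j : (1 - sigma ^+ j) * cover_cost c <=
  residue_mean d j (fun A => \sum_(B : {set T}) c B * phi (B :\: A)).
Proof.
have [c0 c1] := c_cover.
pose w D := \sum_(i : {set T} * {set T})
  (residue_law d j i.1 * c i.2) * (i.2 :\: i.1 == D)%:R.
have wE G : \sum_(D : {set T}) w D * G D =
    residue_mean d j (fun A => \sum_(B : {set T}) c B * G (B :\: A)).
  rewrite (sum_push_set (fun i : {set T} * {set T} => i.2 :\: i.1)
    (fun i => residue_law d j i.1 * c i.2)).
  rewrite -(pair_bigA _ (fun A B => residue_law d j A * c B * G (B :\: A))) /=.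
  apply: eq_bigr => A _; rewrite mulr_sumr; apply: eq_bigr => B _.
  by rewrite mulrA.
rewrite -wE; apply: c_min.
  by rewrite subr_ge0 exprn_ile1 // ltW.
split=> [D|t].
  by apply: sumr_ge0 => i _; rewrite !mulr_ge0 ?residue_law_ge0.
rewrite (wE (fun D => (t \in D)%:R)).
apply: le_trans (_ : residue_mean d j (fun A => 1 + -1 * (t \in A)%:R) <= _).
  rewrite residue_meanD residue_mean_const // residue_meanZ mulN1r.
  by rewrite lerD2l lerN2 residue_mem_small.
apply: le_residue_mean => // A.
under eq_bigr => B _ do rewrite finset.in_setD andbC -mulnb natrM mulrA.
rewrite -mulr_suml; case: (t \in A) => /=.
  by rewrite mulr0 mulr1 subrr.
by rewrite mulr0 addr0 mulr1.
Qed.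

(** Passing from A to A :\: B costs at most phi (A :&: B). The affine bound
    of lower_split_bound, taken at the survival probability sigma^j, is
    averaged and meets residue_removed: the cost of the removed parts cancels
    all of the minimal cost except for the fraction sigma^j. *)
Lemma residue_step j : residue_mean d j phi - residue_mean d j.+1 phi <=
  (sigma `^ Q^-1) ^+ j * (Q * cover_cost c / W).
Proof.
set s := sigma ^+ j; set tau := _ ^+ j.
have s0 : 0 < s by rewrite exprn_gt0.
have tauE : tau = s `^ Q^-1.
  rewrite /tau /s -(powR_mulrn j (powR_ge0 sigma Q^-1)).
  by rewrite -(powR_mulrn j (ltW sigma_gt0)) powRAC.
have tau0 : 0 <= tau by rewrite exprn_ge0 ?powR_ge0.
rewrite residue_meanS.
pose K B := tau / W * (c B * ((1 / s + theta) * phi B)).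
pose bound A := \sum_(B : {set T}) K B
  + - (tau / W / s) * \sum_(B : {set T}) c B * phi (B :\: A).
apply: (@le_trans _ _ (residue_mean d j bound)).
  rewrite lerBlDr -residue_meanD; apply: le_residue_mean => // A.
  rewrite /bound -[phi A]mul1r -d_sum1 mulr_suml mulr_sumr -!big_split /=.
  apply: ler_sum => B _.
  have c0 : 0 <= c B by case: c_cover.
  have := lower_split_bound theta_gt0 s0 (phi_ge0 (B :\: A))
    (phi_ge0 (B :&: A)) (phi_ge0 B) (phi_low B A).
  rewrite -/Q -tauE finset.setIC => Hb.
  apply: (le_trans (ler_wpM2l (d_ge0 B) (phi_sub A B))).
  rewrite mulrDr [leRHS]addrC lerD2l.
  apply: (le_trans (ler_wpM2l (d_ge0 B) Hb)).
  rewrite le_eqVlt; apply/orP; left; apply/eqP.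
  by rewrite /K /d; field; rewrite !gt_eqF.
rewrite /bound residue_meanD residue_mean_const // residue_meanZ.
rewrite -mulr_sumr mulNr.
have -> : \sum_(B : {set T}) c B * ((1 / s + theta) * phi B) =
    (1 / s + theta) * cover_cost c.
  by rewrite mulr_sumr; apply: eq_bigr => B _; rewrite mulrCA.
have k0 : 0 <= tau / W / s by rewrite !divr_ge0 // ltW.
apply: le_trans (lerB (lexx _) (ler_wpM2l k0 (residue_removed j))) _.
rewrite le_eqVlt; apply/orP; left; apply/eqP.
by rewrite -/s /Q; field; rewrite !gt_eqF.
Qed.

(** The residue is nonempty with probability at most the expected number of
    its points. *)
Lemma residue_phi_small j :
  residue_mean d j phi <= phi [set: T]%SET * #|T|%:R * sigma ^+ j.
Proof.
apply: le_trans (_ : residue_mean d j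
    (fun A => phi [set: T]%SET * \sum_t (t \in A)%:R) <= _).
  apply: le_residue_mean => // A; have [->|[t tA]] := finset.set_0Vmem A.
    by rewrite phi_set0 mulr_ge0 ?sumr_ge0.
  rewrite -[leLHS]mulr1 ler_pM ?phi_mono ?finset.subsetT //.
  by rewrite (bigD1 t) //= tA lerDl sumr_ge0.
rewrite residue_meanZ -mulrA ler_wpM2l //.
rewrite /residue_mean; under eq_bigr do rewrite mulr_sumr.
rewrite exchange_big /= mulr_natl -sumr_const.
by apply: ler_sum => t _; exact: residue_mem_small.
Qed.

(** Summing residue_step over j gives a geometric series whose ratio is at most
    1 - 1 / (W Q) by Bernoulli, hence whose sum is at most W Q, while phi of the
    residue tends to 0. *)
Lemma minimal_cover_bound : phi [set: T]%SET <= Q ^+ 2 * cover_cost c.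
Proof.
have Q0 : 0 < Q by rewrite addr_gt0.
have Q1 : 1 < Q by rewrite ltrDl.
set tau := sigma `^ Q^-1; set S := cover_cost c.
have S0 : 0 <= S by apply: sumr_ge0 => B _; rewrite mulr_ge0 //; case: c_cover.
have tau_le : tau <= 1 - W^-1 / Q.
  have := powR_inv_bernoulli Q1 (ltW sigma_gt0).
  have -> // : 1 - sigma = W^-1 by rewrite /sigma opprB addrC subrK.
have tau0 : 0 <= tau by exact: powR_ge0.
have geo J : W^-1 / Q * \sum_(k < J) tau ^+ k <= 1.
  apply: le_trans (_ : (1 - tau) * \sum_(k < J) tau ^+ k <= _).
    apply: ler_wpM2r; last by lra.
    by apply: sumr_ge0 => k _; exact: exprn_ge0.
  by have := subrX1 tau J; have := exprn_ge0 J tau0; rewrite mulrBl; lra.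
have tele J : phi [set: T]%SET - residue_mean d J phi <=
    (\sum_(k < J) tau ^+ k) * (Q * S / W).
  elim: J => [|J IH]; first by rewrite residue_mean0 subrr big_ord0 mul0r.
  rewrite big_ord_recr /= [leRHS]mulrDl.
  by have := lerD IH (residue_step J); rewrite addrA subrK.
have bound J :
    phi [set: T]%SET <= Q ^+ 2 * S + phi [set: T]%SET * #|T|%:R * sigma ^+ J.
  have := residue_phi_small J; have := tele J.
  suff : (\sum_(k < J) tau ^+ k) * (Q * S / W) <= Q ^+ 2 * S by lra.
  rewrite (_ : _ * _ = Q ^+ 2 * S * (W^-1 / Q * \sum_(k < J) tau ^+ k)).
    by rewrite ler_piMr // mulr_ge0 ?exprn_ge0 // ltW.
  by field; rewrite !gt_eqF.
have : Q ^+ 2 * S + phi [set: T]%SET * #|T|%:R * sigma ^+ J @[J --> \oo] -->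
    Q ^+ 2 * S + phi [set: T]%SET * #|T|%:R * 0.
  apply: cvgD; first exact: cvg_cst.
  apply: cvgMr; apply: cvg_expr; rewrite ger0_norm //; exact: ltW.
rewrite mulr0 addr0 => lim.
by apply: (cvgr_to_ge lim); apply: nearW => J; exact: bound.
Qed.

End Minimal.
End FractionalCover.

(** * Existence of a minimal cover and the cover bound *)

Section MinimalCover.
Context {R : realType} {T : finType}.
Implicit Types (A B : {set T}) (c w : {set T} -> R).

Import ArrowAsProduct.

Lemma linear_form_continuous (a : {set T} -> R) :
  continuous (fun c : {set T} -> R => \sum_(B : {set T}) c B * a B).
Proof.
move=> c.
apply: (@cvg_big R {set T} +%R 0 xpredT (@add_continuous R) _ (nbhs c)
  (index_enum {set T}) (fun B v => v B * a B) (fun B => c B * a B)).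
move=> B _; apply: cvgMl; exact: (@proj_continuous _ (fun=> R) B).
Qed.

(** Confines the search for a minimal cover to a compact cube. *)
Lemma cover_truncate c : fractional_cover 1 c ->
  fractional_cover 1 (fun B => Num.min (c B) 1).
Proof.
move=> [c0 c1]; have m0 B : 0 <= Num.min (c B) 1 by rewrite le_min c0 ler01.
split=> // t.
have [/existsP[B /andP[tB B1]]|/existsPn small] :=
    boolP [exists B : {set T}, (t \in B) && (1 <= c B)].
  rewrite (bigD1 B) //= tB mulr1 (min_idPr B1) lerDl.
  by apply: sumr_ge0 => C _; rewrite mulr_ge0.
apply: (le_trans (c1 t)); apply: ler_sum => B _.
have := small B; case: (t \in B); rewrite /= ?mulr0 // -ltNge !mulr1 => B1.
by rewrite le_min lexx ltW.
Qed.

Lemma exists_minimal_cover (phi : {set T} -> R) : (forall A, 0 <= phi A) ->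
  exists2 c, fractional_cover 1 c &
    forall w, fractional_cover 1 w -> cover_cost phi c <= cover_cost phi w.
Proof.
move=> phi0.
pose box : set ({set T} -> R) := [set c | forall B, (`[0, 1]%classic : set R) (c B)].
pose cov : set ({set T} -> R) := \bigcap_(t in [set: T])
  ((fun c => \sum_(B : {set T}) c B * (t \in B)%:R) @^-1` [set x | 1 <= x]).
have box_compact : compact box.
  by apply: (@tychonoff _ (fun=> R) (fun=> `[0, 1]%classic)) => B; exact: segment_compact.
have cov_closed : closed cov.
  apply: closed_bigI => t _; apply: preimage_closed; last exact: closed_ge.
  by move=> c _; exact: linear_form_continuous.
have coverE c : (box `&` cov) c -> fractional_cover 1 c.
  move=> [bc cc]; split=> [B|t]; last exact: cc.
  by have /= := bc B; rewrite in_itv /= => /andP[].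
have min_in c : fractional_cover 1 c ->
    (box `&` cov) (fun B => Num.min (c B) 1).
  move=> cc; have [m0 m1] := cover_truncate cc; split=> [B|t _] /=.
    by rewrite in_itv /= m0 ge_min lexx orbT.
  exact: m1.
have one_cover : @fractional_cover R T 1 (fun=> 1).
  split=> [B|u]; first exact: ler01.
  rewrite (bigD1 [set: T]%SET) //= finset.in_setT mulr1 lerDl.
  by apply: sumr_ge0 => B _; rewrite mul1r.
have ne : (box `&` cov) !=set0 by eexists; exact: (min_in _ one_cover).
have [c cin cmin] := compact_EVT_min ne (compact_closedI box_compact cov_closed)
  (continuous_subspaceT (@linear_form_continuous phi)).
exists c; first by apply: coverE; rewrite inE in cin.
move=> w wc; have := cmin _ (mem_set (min_in _ wc)).
move=> /le_trans; apply; apply: ler_sum => B _.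
by rewrite ler_wpM2r // ge_min lexx.
Qed.

End MinimalCover.

Section CoverBound.
Context {R : realType} {T : finType} (phi : {set T} -> R) (theta : R).
Hypotheses (theta_gt0 : 0 < theta) (phi_ge0 : forall A, 0 <= phi A).
Hypothesis phi_mono : forall A B : {set T}, A \subset B -> phi A <= phi B.
Hypothesis phi_sub : forall A B : {set T}, phi A <= phi (A :\: B) + phi (A :&: B).
Hypothesis phi_low : forall A B : {set T},
  phi (A :&: B) `^ (1 + theta) + phi (A :\: B) `^ (1 + theta)
    <= phi A `^ (1 + theta).

Lemma fractional_cover_bound (w : {set T} -> R) : fractional_cover 1 w ->
  phi [set: T]%SET <= (1 + theta) ^+ 2 * cover_cost phi w.
Proof.
move=> wc.
have phi00 := phi_set0 phi_low.
have cost0 v : (forall B, 0 <= v B) -> 0 <= cover_cost phi v.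
  by move=> v0; apply: sumr_ge0 => B _; rewrite mulr_ge0.
have [T0|[t _]] := finset.set_0Vmem [set: T]%SET.
  by rewrite T0 phi00 mulr_ge0 ?sqr_ge0 // cost0 //; case: wc.
have [c [c0 c1] cmin] := exists_minimal_cover phi_ge0.
(* Weight on the empty set is free and makes the total mass exceed 1, so that
the survival probability stays positive. *)
pose c' B := c B + (B == finset.set0)%:R.
have c'cost : cover_cost phi c' = cover_cost phi c.
  rewrite /cover_cost /c'; apply: eq_bigr => B _.
  by rewrite mulrDl; case: eqP => [->|]; rewrite ?phi00 ?mulr0 ?mul0r addr0.
have c'0 B : 0 <= c' B by rewrite addr_ge0.
have c'cover : fractional_cover 1 c'.
  split=> // u; apply: (le_trans (c1 u)); apply: ler_sum => B _.
  by rewrite ler_wpM2r // lerDl.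
apply: (@le_trans _ _ ((1 + theta) ^+ 2 * cover_cost phi c')); last first.
  by rewrite ler_wpM2l ?sqr_ge0 // c'cost cmin.
apply: minimal_cover_bound => // [lambda v l0 [v0 vl]|].
  have [->|ln0] := eqVneq lambda 0; first by rewrite mul0r cost0.
  have lp : 0 < lambda by rewrite lt_neqAle eq_sym ln0.
  have : cover_cost phi c <= cover_cost phi (fun B => lambda^-1 * v B).
    apply: cmin; split=> [B|u]; first by rewrite mulr_ge0 ?invr_ge0.
    under eq_bigr do rewrite -mulrA.
    by rewrite -mulr_sumr -[X in X <= _](mulVf ln0) ler_wpM2l ?invr_ge0.
  rewrite c'cost /cover_cost; under [leRHS]eq_bigr do rewrite -mulrA.
  by rewrite -[X in _ <= X -> _]mulr_sumr ler_pdivlMl.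
rewrite big_split /= (bigD1 (finset.set0 : {set T})
  (F := fun B => (B == finset.set0)%:R)) //= eqxx.
have : 1 <= \sum_(B : {set T}) c B.
  apply: (le_trans (c1 t)); apply: ler_sum => B _.
  by case: (t \in B); rewrite ?mulr1 ?mulr0.
have : 0 <= \sum_(B : {set T} | B != finset.set0) (B == finset.set0)%:R :> R.
  exact: sumr_ge0.
move=> e0 m1; apply: (@lt_le_trans _ _ (1 + 1)); first by rewrite ltrDl.
by rewrite lerD // lerDl.
Qed.

(** Points of a null set Z may be left uncovered: Z itself, with weight 1,
    completes the cover at no cost. *)
Lemma indexed_cover_bound (I : finType) (c : I -> R) (A : I -> {set T})
    (Z : {set T}) : (forall i, 0 <= c i) -> phi Z = 0 ->
  (forall t, t \notin Z -> 1 <= \sum_i c i * (t \in A i)%:R) ->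
  phi [set: T]%SET <= (1 + theta) ^+ 2 * \sum_i c i * phi (A i).
Proof.
move=> c0 Z0 cov.
pose w B := \sum_i c i * (A i == B)%:R + (B == Z)%:R.
have wE (G : {set T} -> R) :
    \sum_(B : {set T}) w B * G B = \sum_i c i * G (A i) + G Z.
  rewrite /w; under eq_bigr do rewrite mulrDl.
  rewrite big_split /= sum_push_set; congr (_ + _).
  rewrite (bigD1 Z) //= eqxx mul1r big1 ?addr0 // => B /negbTE ->.
  by rewrite mul0r.
have -> : \sum_i c i * phi (A i) = cover_cost phi w.
  by rewrite /cover_cost wE Z0 addr0.
apply: fractional_cover_bound; split.
  by move=> B; rewrite addr_ge0 // sumr_ge0 // => i _; rewrite mulr_ge0.
move=> t; rewrite (wE (fun B => (t \in B)%:R)).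
have [tZ|/cov tZ] := boolP (t \in Z); last by rewrite addr0.
by rewrite lerDr; apply: sumr_ge0 => i _; rewrite mulr_ge0.
Qed.

End CoverBound.

(** * Borel functions *)

Section BorelFunctions.
Context {R : realType} {Omega : topologicalType} (x0 : Omega).
Implicit Types f g : Omega -> R.

(** The measurable structure generated by the open sets is attached to pointed
    spaces, so a point of the space is needed to use the measurability
    lemmas. *)
Definition pointed_copy : ptopologicalType :=
  HB.pack (Omega : Type) Omega (isPointed.Build Omega x0).

Lemma borel_measurable f : borel_fun f <->
  measurable_fun [set: g_sigma_algebraType (@open pointed_copy)]
    (f : g_sigma_algebraType (@open pointed_copy) -> R).
Proof. exact: (@borel_funE R pointed_copy f). Qed.

Lemma borel_fun_cst a : borel_fun (fun _ : Omega => a : R).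
Proof. by apply/borel_measurable; exact: measurable_cst. Qed.

Lemma borel_funB f g : borel_fun f -> borel_fun g ->
  borel_fun (fun x => f x - g x).
Proof.
move=> /borel_measurable mf /borel_measurable mg.
by apply/borel_measurable; exact: measurable_funB.
Qed.

Lemma borel_funM f g : borel_fun f -> borel_fun g ->
  borel_fun (fun x => f x * g x).
Proof.
move=> /borel_measurable mf /borel_measurable mg.
by apply/borel_measurable; exact: measurable_funM.
Qed.

Lemma borel_fun_sum (I : finType) (f : I -> Omega -> R) :
  (forall i, borel_fun (f i)) -> borel_fun (fun x => \sum_i f i x).
Proof.
move=> mf; apply/borel_measurable; apply: measurable_sum => i.
exact/borel_measurable.
Qed.

Lemma borel_fun_prod (I : finType) (f : I -> Omega -> R) :
  (forall i, borel_fun (f i)) -> borel_fun (fun x => \prod_i f i x).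
Proof.
move=> mf; apply/borel_measurable; apply: measurable_prod => i _.
exact/borel_measurable.
Qed.

Lemma borel_fun_powR f r : borel_fun f -> borel_fun (fun x => `|f x| `^ r).
Proof.
move=> /borel_measurable mf; apply/borel_measurable.
apply: (measurableT_comp (measurable_powR r)).
exact: (measurableT_comp (@normr_measurable R setT)).
Qed.

Lemma borel_fun_ler f g : borel_fun f -> borel_fun g ->
  borel_fun (fun x => (f x <= g x)%R%:R : R).
Proof.
move=> /borel_measurable mf /borel_measurable mg; apply/borel_measurable.
have -> : (fun x => (f x <= g x)%R%:R : R) =
    (fun x => if (f x <= g x)%R then 1 else 0) by apply/funext => x; case: ifP.
apply: measurable_fun_ifT; try exact: measurable_cst.
exact: measurable_fun_ler.
Qed.

Lemma borel_fun_negb (e : Omega -> bool) :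
  borel_fun (fun x => (e x)%:R : R) -> borel_fun (fun x => (~~ e x)%:R : R).
Proof.
move=> me; have -> : (fun x => (~~ e x)%:R : R) = (fun x => 1 - (e x)%:R).
  by apply/funext => x; case: (e x); rewrite /= ?subrr ?subr0.
by apply: borel_funB => //; exact: borel_fun_cst.
Qed.

(** The set of all j such that e j x holds is the type of x with respect to the
    predicates e. A union of types is Borel since there are finitely many of
    them. *)
Lemma borel_fun_type (J : finType) (e : J -> Omega -> bool) (A : {set {set J}}) :
  (forall j, borel_fun (fun x => (e j x)%:R : R)) ->
  borel_fun (fun x => ([set j | e j x]%SET \in A)%:R : R).
Proof.
move=> me.
have -> : (fun x => ([set j | e j x]%SET \in A)%:R : R) = (fun x =>
    \sum_(t : {set J}) (t \in A)%:R *
      \prod_j (if j \in t then (e j x)%:R else (~~ e j x)%:R)).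
  apply/funext => x.
  rewrite (bigD1 [set j | e j x]%SET) //= [X in _ = _ * X + _]big1.
    rewrite mulr1 big1 ?addr0 // => t tx.
    suff /existsP[j ej] : [exists j, (j \in t) != e j x].
      rewrite (bigD1 j) //=; move: ej.
      by case: (j \in t); case: (e j x); rewrite //= mul0r mulr0.
    apply: contraR tx => /existsPn tx; apply/eqP/finset.setP => j.
    by rewrite finset.inE; move: (tx j); rewrite negbK => /eqP.
  by move=> j _; rewrite finset.inE; case: (e j x).
apply: borel_fun_sum => t; apply: borel_funM; first exact: borel_fun_cst.
apply: borel_fun_prod => j; case: (j \in t) => //.
exact: borel_fun_negb.
Qed.

End BorelFunctions.

(** * The cover bound in a function space *)

Lemma sum_enum_val (V : nmodType) (J : finType) (F : J -> V) :
  \sum_(i < #|J|) F (enum_val i) = \sum_j F j.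
Proof. by rewrite -big_enum_val. Qed.

Section FunctionSpace.
Context {R : realType} {Omega : topologicalType} (x0 : Omega).
Context (X : qBanach_function_space R Omega).
Implicit Types f g h : Omega -> R.

Definition rnorm f : R := fine (qnorm X f).

Lemma rnorm_ge0 f : borel_fun f -> 0 <= rnorm f.
Proof. by move=> bf; apply: fine_ge0; exact: (aq_ge0 (qnorm_admissible X)). Qed.

Lemma rnormE f : in_space X f -> qnorm X f = (rnorm f)%:E.
Proof.
move=> [bf ff]; rewrite /rnorm fineK // ge0_fin_numE //.
exact: (aq_ge0 (qnorm_admissible X)).
Qed.

Lemma in_space_le f g : borel_fun g -> (forall x, `|g x| <= `|f x|) ->
  in_space X f -> in_space X g.
Proof.
move=> bg gf [bf ff]; split=> //; apply: le_lt_trans ff.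
exact: (aq_mono (qnorm_admissible X)).
Qed.

Lemma le_rnorm f g : borel_fun g -> (forall x, `|g x| <= `|f x|) ->
  in_space X f -> rnorm g <= rnorm f.
Proof.
move=> bg gf sf; have sg := in_space_le bg gf sf.
rewrite -lee_fin -!rnormE //.
by case: sf => bf _; exact: (aq_mono (qnorm_admissible X)).
Qed.

Lemma rnormZ a f : in_space X f -> rnorm (fun x => a * f x) = `|a| * rnorm f.
Proof.
move=> sf; rewrite /rnorm (aq_homog (qnorm_admissible X)); last by case: sf.
by rewrite rnormE.
Qed.

Lemma in_spaceZ a f : in_space X f -> in_space X (fun x => a * f x).
Proof.
move=> sf; have [bf _] := sf; split.
  by apply: (borel_funM x0) => //; exact: (borel_fun_cst x0).
rewrite (aq_homog (qnorm_admissible X)) // rnormE // -EFinM; exact: ltry.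
Qed.

Lemma rnorm0 : rnorm (fun=> 0) = 0.
Proof.
have := aq_homog (qnorm_admissible X) 0 (borel_fun_cst x0 0).
by rewrite /rnorm normr0 mul0e mulr0 => ->.
Qed.

Context (p theta : R).
Hypotheses (p_gt0 : 0 < p) (theta_gt0 : 0 < theta).
Hypothesis upper : upper_estimate X p.
Hypothesis lower : lower_estimate X (p * (1 + theta)).

Let q := p * (1 + theta).

Definition disjoint_family (J : finType) (g : J -> Omega -> R) :=
  forall i j x, g i x != 0 -> g j x != 0 -> i = j.

Lemma trivIset_supp n (J : finType) (g : J -> Omega -> R) (s : 'I_n -> J) :
  injective s -> disjoint_family g ->
  trivIset [set: 'I_n] (fun i => supp (g (s i))).
Proof.
move=> si dg; apply/trivIsetP => i j _ _ ij; apply/seteqP; split=> x //=.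
case; rewrite /supp /= => /eqP gi /eqP gj.
by apply/(negP ij)/eqP/si/(dg _ _ x).
Qed.

Lemma lower_rnorm (J : finType) (g : J -> Omega -> R) h :
  in_space X h -> (forall i, borel_fun (g i)) -> disjoint_family g ->
  (forall i x, `|g i x| <= `|h x|) ->
  \sum_i rnorm (g i) `^ q <= rnorm h `^ q.
Proof.
move=> sh bg dg gh.
have q0 : 0 < q by rewrite mulr_gt0 // addr_gt0.
have sg i : in_space X (g i) by apply: in_space_le sh.
have := lower (fun i : 'I_#|J| => sg (enum_val i))
  (trivIset_supp enum_val_inj dg).
under eq_bigr do rewrite rnormE // poweR_EFin.
rewrite sumEFin poweR_EFin.
set S := fun x : Omega => _; set r := _ `^ _.
have bS : borel_fun S by apply: (borel_fun_sum x0) => i.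
have Sh x : `|S x| <= `|h x|.
  rewrite /S (sum_enum_val (g^~ x)).
  have [/existsP[i gi]|/existsPn g0] := boolP [exists i, g i x != 0].
    rewrite (bigD1 i) //= big1 ?addr0 // => j ji.
    by apply/eqP; apply: contraNT ji => gj; apply/eqP/(dg _ _ x).
  by rewrite big1 ?normr0 // => i _; apply/eqP; have := g0 i; rewrite negbK.
have sS := in_space_le bS Sh sh.
rewrite rnormE // lee_fin => /le_trans /(_ (le_rnorm bS Sh sh)).
have r0 : 0 <= \sum_(i < #|J|) rnorm (g (enum_val i)) `^ q.
  by apply: sumr_ge0 => i _; exact: powR_ge0.
move=> /(ge0_ler_powR (ltW q0) (powR_ge0 _ _) (rnorm_ge0 (proj1 sh))).
rewrite /r -powRrM mulVf ?gt_eqF // powRr1 //.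
by rewrite (sum_enum_val (fun j => rnorm (g j) `^ q)).
Qed.

Lemma upper_rnorm (J : finType) (g : J -> Omega -> R) :
  (forall i, in_space X (g i)) -> disjoint_family g ->
  in_space X (fun x => \sum_i g i x) /\
  rnorm (fun x => \sum_i g i x) `^ p <= \sum_i rnorm (g i) `^ p.
Proof.
move=> sg dg.
have := upper (fun i : 'I_#|J| => sg (enum_val i))
  (trivIset_supp enum_val_inj dg).
under eq_bigr do rewrite rnormE // poweR_EFin.
rewrite sumEFin poweR_EFin.
rewrite (sum_enum_val (fun j => rnorm (g j) `^ p)).
rewrite (_ : (fun x => _) = (fun x => \sum_i g i x)); last first.
  by apply/funext => x; rewrite (sum_enum_val (g^~ x)).
set S := fun x => _ => SS.
have bS : borel_fun S by apply: (borel_fun_sum x0) => i; case: (sg i).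
have sS : in_space X S by split=> //; apply: le_lt_trans SS _; exact: ltry.
split=> //; move: SS; rewrite rnormE // lee_fin.
move=> /(ge0_ler_powR (ltW p_gt0) (rnorm_ge0 bS) (powR_ge0 _ _)).
rewrite -powRrM mulVf ?gt_eqF // powRr1 //.
by apply: sumr_ge0 => i _; exact: powR_ge0.
Qed.

(** indexed_cover_bound for the set function that sends a set of types A to
    the p-th power of the norm of f cut down to the points with type in A. Types
    that are left uncovered are met only where f vanishes. *)
Lemma rnorm_cover_bound (J : finType) (e : J -> Omega -> bool) (c : J -> R) f :
  in_space X f -> (forall j, borel_fun (fun x => (e j x)%:R : R)) ->
  (forall j, 0 <= c j) ->
  (forall x, f x != 0 -> 1 <= \sum_j c j * (e j x)%:R) ->
  rnorm f `^ p <=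
    (1 + theta) ^+ 2 * \sum_j c j * rnorm (fun x => f x * (e j x)%:R) `^ p.
Proof.
move=> sf be c0 cov; have [bf _] := sf.
pose ty x := [set j | e j x]%SET.
pose cut (A : {set {set J}}) x := f x * (ty x \in A)%:R.
have bcut A : borel_fun (cut A).
  by apply: (borel_funM x0) => //; exact: borel_fun_type.
have cut_le (A B : {set {set J}}) x : A \subset B -> `|cut A x| <= `|cut B x|.
  move=> /fintype.subsetP AB; rewrite /cut !normrM ler_wpM2l // !normr_nat ler_nat.
  by have := AB (ty x); case: (_ \in A) => // ->.
have cutT : cut [set: {set J}]%SET = f.
  by apply/funext => x; rewrite /cut finset.in_setT mulr1.
have scut A : in_space X (cut A).
  apply: in_space_le sf => // x; rewrite -cutT; apply: cut_le.
  exact: finset.subsetT.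
pose phi A := rnorm (cut A) `^ p.
have dcut (A B : {set {set J}}) :
    disjoint_family (fun b : bool => cut (if b then A :&: B else A :\: B)).
  move=> b b' x; rewrite /cut.
  case: b; case: b' => //; rewrite finset.in_setI finset.in_setD;
    by case: (_ \in B); rewrite /= ?andbF ?andbT ?mulr0 ?eqxx.
have := @indexed_cover_bound R {set J} phi theta theta_gt0 _ _ _ _ J c
  (fun j => [set t : {set J} | j \in t]%SET)
  [set t : {set J} | ~~ (1 <= \sum_j c j * (j \in t)%:R)]%SET c0.
have -> : phi [set: {set J}]%SET = rnorm f `^ p by rewrite /phi cutT.
have cutj j : cut [set t : {set J} | j \in t]%SET = (fun x => f x * (e j x)%:R).
  by apply/funext => x; rewrite /cut !finset.inE.
under eq_bigr do rewrite /phi cutj.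
apply.
- by move=> A; exact: powR_ge0.
- move=> A B AB; rewrite /phi ler_powR2r ?rnorm_ge0 //.
  apply: (le_rnorm (bcut A) _ (scut B)) => x; exact: cut_le.
- move=> A B; have [_] := upper_rnorm
    (fun b => scut (if b then A :&: B else A :\: B)) (dcut A B).
  rewrite big_bool /= addrC; congr (rnorm _ `^ p <= _).
  apply/funext => x; rewrite big_bool /= /cut -mulrDr finset.in_setI finset.in_setD.
  by case: (_ \in A); case: (_ \in B); rewrite /= ?addr0 ?add0r.
- move=> A B; rewrite /phi -!powRrM.
  have := lower_rnorm (scut A)
    (fun b => bcut (if b then A :&: B else A :\: B)) (dcut A B).
  rewrite big_bool; apply => b x; apply: cut_le.
  by case: b; rewrite ?finset.subsetIl ?finset.subsetDl.
- rewrite /phi (_ : cut _ = fun=> 0) ?rnorm0 ?powR0 ?gt_eqF //.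
  apply/funext => x; rewrite /cut finset.inE.
  have [->|/cov cx] := eqVneq (f x) 0; first by rewrite mul0r.
  under eq_bigr do rewrite /ty finset.inE.
  by rewrite cx mulr0.
- move=> t; rewrite finset.inE negbK => t1.
  by under eq_bigr do rewrite finset.inE.
Qed.

End FunctionSpace.

(** * Sums over geometric levels *)

Section LevelSums.
Context {R : realType} (s theta : R).
Hypotheses (s_gt1 : 1 < s) (theta_gt0 : 0 < theta).

(** The zero of the tangent line 1 + s (z - 1): smaller values of z do not
    contribute to the cover. *)
Definition base_level : R := 1 - s^-1.
Definition level (k : nat) : R := base_level * expR theta ^+ k.
(** The positive part of the tangent line at z = 1 to z^s. *)
Definition tangent (z : R) : R := Num.max 0 (1 + s * (z - 1)).
(** The sum of tangent(z) / z^s over the levels is at most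
    level_const / theta. *)
Definition level_const : R := s * base_level `^ (1 - s) / (s - 1).

Let s_gt0 : 0 < s. Proof. exact: lt_trans s_gt1. Qed.
Let sm1_gt0 : 0 < s - 1. Proof. by rewrite subr_gt0. Qed.

Lemma base_level_gt0 : 0 < base_level.
Proof. by rewrite subr_gt0 invf_lt1. Qed.

Lemma level_gt0 k : 0 < level k.
Proof. by rewrite mulr_gt0 ?base_level_gt0 ?exprn_gt0 ?expR_gt0. Qed.

Lemma levelS k : level k.+1 = expR theta * level k.
Proof. by rewrite /level exprS mulrCA. Qed.

Lemma tangent_ge0 z : 0 <= tangent z.
Proof. by rewrite le_max lexx. Qed.

Lemma tangent_mono y z : y <= z -> tangent y <= tangent z.
Proof.
move=> yz; rewrite /tangent ge_max le_max lexx /= le_max; apply/orP; right.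
by rewrite lerD2l ler_pM2l // lerD2r.
Qed.

Lemma tangent_base z : z <= base_level -> 1 + s * (z - 1) <= 0.
Proof.
move=> zb; have : s * z <= s * base_level by rewrite ler_pM2l.
rewrite /base_level !mulrBr mulr1 divff ?gt_eqF //; lra.
Qed.

Lemma tangent_ratio_le1 z : 0 < z -> tangent z / z `^ s <= 1.
Proof.
move=> z0; rewrite ler_pdivrMr ?powR_gt0 // mul1r /tangent ge_max powR_ge0 /=.
by apply: powR_bernoulli => //; exact: ltW.
Qed.

Lemma tangent_ratio_le z : 0 < z -> tangent z / z `^ s <= s * z `^ (1 - s).
Proof.
move=> z0; rewrite ler_pdivrMr ?powR_gt0 // -mulrA -powRD; last first.
  by apply/implyP => _; rewrite gt_eqF.
rewrite subrK powRr1 ?(ltW z0) // /tangent ge_max.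
rewrite (mulr_ge0 (ltW s_gt0) (ltW z0)) /= mulrBr mulr1.
have := s_gt1; lra.
Qed.

Lemma level_const_gt0 : 0 < level_const.
Proof.
apply: divr_gt0 => //; apply: mulr_gt0 => //; apply: powR_gt0.
exact: base_level_gt0.
Qed.

(** The terms are dominated by a geometric series with ratio
    e^(-(s-1) theta), whose sum is at most 1 / ((s - 1) theta). *)
Lemma sum_tangent_ratio N :
  \sum_(k < N) tangent (level k.+1) / level k.+1 `^ s <= level_const / theta.
Proof.
set mu := expR theta `^ (1 - s).
have mu0 : 0 < mu by rewrite powR_gt0 ?expR_gt0.
have lvl k : level k `^ (1 - s) = base_level `^ (1 - s) * mu ^+ k.
  rewrite /level powRM ?exprn_ge0 ?expR_ge0 ?(ltW base_level_gt0) //.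
  rewrite -(powR_mulrn _ (expR_ge0 theta)) -(powR_mulrn _ (ltW mu0)).
  by rewrite powRAC.
have muV : 1 + (s - 1) * theta <= mu^-1.
  rewrite -powRN opprB /powR gt_eqF ?expR_gt0 // expRK; exact: expR_ge1Dx.
have tel : \sum_(k < N) mu ^+ k.+1 * ((s - 1) * theta) <= 1.
  have : \sum_(k < N) mu ^+ k.+1 * ((s - 1) * theta) <=
      \sum_(k < N) mu ^+ k.+1 * (mu^-1 - 1).
    apply: ler_sum => k _; rewrite ler_pM2l ?exprn_gt0 //; lra.
  move=> /le_trans; apply.
  have -> : \sum_(k < N) mu ^+ k.+1 * (mu^-1 - 1) = 1 - mu ^+ N.
    elim: N => [|N IH]; first by rewrite big_ord0 expr0 subrr.
    rewrite big_ord_recr /= IH exprS; field; exact: lt0r_neq0.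
  by rewrite gerBl exprn_ge0 // ltW.
apply: (@le_trans _ _ (\sum_(k < N) s * (base_level `^ (1 - s) * mu ^+ k.+1))).
  by apply: ler_sum => k _; rewrite -lvl tangent_ratio_le ?level_gt0.
have -> : \sum_(k < N) s * (base_level `^ (1 - s) * mu ^+ k.+1) =
    level_const / theta * \sum_(k < N) mu ^+ k.+1 * ((s - 1) * theta).
  rewrite mulr_sumr; apply: eq_bigr => k _; rewrite /level_const; field.
  by rewrite !gt_eqF.
by rewrite ler_piMr // divr_ge0 ?ltW ?level_const_gt0.
Qed.

(** Hölder's inequality with exponents Q' = Q / theta and Q. The ratios are at
    most 1, so their Q'-th powers are bounded by the ratios themselves, which
    sum_tangent_ratio controls. This is the only source of the term in
    |ln theta|. *)
Lemma holder_levels N (e : 'I_N -> R) : (forall k, 0 <= e k) ->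
  \sum_k e k `^ (1 + theta) <= 1 ->
  \sum_(k < N) tangent (level k.+1) / level k.+1 `^ s * e k <=
    (level_const / theta) `^ (theta / (1 + theta)).
Proof.
move=> e0 e1; set D := _ `^ _.
have Q0 : 0 < 1 + theta by rewrite addr_gt0.
have Q'0 : 0 < (1 + theta) / theta by rewrite divr_gt0.
have C0 : 0 < level_const / theta by rewrite divr_gt0 ?level_const_gt0.
have D0 : 0 < D by exact: powR_gt0.
have DQ : D `^ ((1 + theta) / theta) = level_const / theta.
  rewrite /D -powRrM (_ : theta / (1 + theta) * ((1 + theta) / theta) = 1).
    by rewrite powRr1 // ltW.
  by field; rewrite !gt_eqF.
have conj : ((1 + theta) / theta)^-1 + (1 + theta)^-1 = 1.
  by field; rewrite !gt_eqF.
set b := fun k : 'I_N => tangent (level k.+1) / level k.+1 `^ s.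
have b0 k : 0 <= b k by rewrite divr_ge0 ?tangent_ge0 ?powR_ge0.
have bQ : \sum_k b k `^ ((1 + theta) / theta) <= level_const / theta.
  apply: le_trans (sum_tangent_ratio N); apply: ler_sum => k _.
  rewrite -/(b k); have := b0 k; rewrite le_eqVlt => /predU1P[<-|bp].
    by rewrite powR0 ?gt_eqF.
  apply: ge1r_powR; first by rewrite bp /b tangent_ratio_le1 ?level_gt0.
  by rewrite ler_pdivlMr // mul1r lerDr.
have : \sum_k b k / D * e k <= 1.
  apply: (@le_trans _ _ (\sum_k ((b k `^ ((1 + theta) / theta)) *
     ((level_const / theta)^-1 / ((1 + theta) / theta))
     + e k `^ (1 + theta) / (1 + theta)))).
    apply: ler_sum => k _.
    have := conjugate_powR (divr_ge0 (b0 k) (ltW D0)) (e0 k) Q'0 Q0 conj.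
    rewrite powRM ?invr_ge0 ?(ltW D0) //.
    have -> : D^-1 `^ ((1 + theta) / theta) = (level_const / theta)^-1.
      by rewrite -powR_inv1 ?(ltW D0) // powRAC DQ powR_inv1 // ltW.
    by rewrite -!mulrA.
  rewrite big_split /= -!mulr_suml -[leRHS]conj lerD //.
    rewrite mulrA ler_piMl ?invr_ge0 ?(ltW Q'0) //.
    by rewrite ler_pdivrMr // mul1r.
  by rewrite ler_piMl // invr_ge0 ltW.
rewrite (_ : \sum_k _ = D^-1 * \sum_k b k * e k); last first.
  by rewrite mulr_sumr; apply: eq_bigr => k _; rewrite mulrAC mulrC.
by rewrite mulrC ler_pdivrMr // mul1r.
Qed.

(** The three factors are the loss of the cover bound, the loss from rounding
    to the levels, and the loss in Hölder's inequality. *)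
Definition power_bound : R := (1 + theta) ^+ 2 * expR theta `^ s *
  (level_const / theta) `^ (theta / (1 + theta)).

Lemma power_bound_gt0 : 0 < power_bound.
Proof.
rewrite /power_bound !mulr_gt0 ?exprn_gt0 ?addr_gt0 ?powR_gt0 ?expR_gt0 //.
by rewrite divr_gt0 ?level_const_gt0.
Qed.

Lemma ln_power_bound p : 0 < p -> ln (power_bound `^ p^-1) <=
  theta * ((2 + s + `|ln level_const|) / p + p^-1 * `|ln theta|).
Proof.
move=> p0.
have Q0 : 0 < 1 + theta by rewrite addr_gt0.
have C0 := level_const_gt0; have Ct0 := divr_gt0 C0 theta_gt0.
rewrite ln_powR [leRHS](_ : _ = p^-1 *
  (theta * (2 + s + `|ln level_const| + `|ln theta|))); last by ring.
rewrite ler_pM2l ?invr_gt0 //.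
rewrite /power_bound lnM ?posrE ?mulr_gt0 ?exprn_gt0 ?powR_gt0 ?expR_gt0 //.
rewrite lnM ?posrE ?exprn_gt0 ?powR_gt0 ?expR_gt0 //.
rewrite lnXn // ln_powR expRK ln_powR ln_div ?posrE //.
have lQ : ln (1 + theta) <= theta by apply: le_ln1Dx; lra.
have : theta / (1 + theta) * (ln level_const - ln theta) <=
    theta * (`|ln level_const| + `|ln theta|).
  apply: (@le_trans _ _ (theta / (1 + theta) *
      (`|ln level_const| + `|ln theta|))).
    rewrite ler_pM2l ?divr_gt0 // lerD ?ler_norm // -normrN ler_norm //.
  rewrite ler_wpM2r ?addr_ge0 // ler_pdivrMr // ler_peMr ?lerDl ?ltW //.
by move: lQ; rewrite mulr2n; lra.
Qed.

Lemma level_unbounded (a : R) : exists N, a < level N.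
Proof.
have [N aN] : exists N : nat, a / base_level / theta < N%:R.
  exists (Num.truncn (a / base_level / theta)).+1.
  exact: truncnS_gt.
exists N; rewrite /level mulrC -ltr_pdivrMr ?base_level_gt0 //.
rewrite ltr_pdivrMr // in aN; apply: (lt_le_trans aN).
rewrite -expRM_natl; apply: le_trans (expR_ge1Dx _).
by rewrite lerDr.
Qed.

End LevelSums.

(** * Convexity of the function space *)

Section Convexity.
Context {R : realType} {Omega : topologicalType} (x0 : Omega).
Context (X : qBanach_function_space R Omega).
Context (r p theta : R).
Hypotheses (r_gt0 : 0 < r) (r_lt_p : r < p).
Hypotheses (theta_gt0 : 0 < theta).
Hypothesis upper : upper_estimate X p.
Hypothesis lower : lower_estimate X (p * (1 + theta)).

Let s := p / r.
Let p_gt0 : 0 < p. Proof. exact: lt_trans r_lt_p. Qed.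
Let s_gt1 : 1 < s. Proof. by rewrite ltr_pdivlMr // mul1r. Qed.
Let s_gt0 : 0 < s. Proof. exact: lt_trans s_gt1. Qed.

(** The maximum is the sum of two disjointly supported pieces, to which the
    upper estimate applies. *)
Lemma in_space_max (f g : Omega -> R) : in_space X f -> in_space X g ->
  in_space X (fun x => Num.max `|f x| `|g x|).
Proof.
move=> sf sg; have [bf _] := sf; have [bg _] := sg.
have babs (h : Omega -> R) : borel_fun h -> borel_fun (fun x => `|h x|).
  move=> bh; rewrite (_ : (fun x => _) = (fun x => `|h x| `^ 1)).
    exact: (borel_fun_powR x0).
  by apply/funext => x; rewrite powRr1.
pose e (b : bool) x := b (+) (`|f x| <= `|g x|)%R.
have be b : borel_fun (fun x => (e b x)%:R : R).
  have := borel_fun_ler x0 (babs _ bf) (babs _ bg); rewrite /e.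
  by case: b => // /(borel_fun_negb x0).
pose k (b : bool) x := (if b then `|f x| else `|g x|) * (e b x)%:R.
have kle b x : `|k b x| <= `|(if b then f else g) x|.
  rewrite /k normrM normr_nat; case: b; rewrite normr_id ler_piMr // lern1;
  by case: (e _ x).
have sk b : in_space X (k b).
  apply: (in_space_le _ (kle b)); last by case: b.
  apply: (borel_funM x0) => //.
  by case: b; exact: babs.
have dk : disjoint_family k.
  by move=> b b' x; rewrite /k /e; case: b; case: b' => //=;
     case: (_ <= _); rewrite /= ?mulr0 ?eqxx.
have [+ _] := upper_rnorm x0 p_gt0 upper sk dk.
congr (in_space X _); apply/funext => x; rewrite big_bool /k /e /=.
by case: leP; rewrite /= ?mulr0 ?mulr1 ?addr0 ?add0r.
Qed.

Lemma exists_common_bound n (f : 'I_n -> Omega -> R) :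
  (forall i, in_space X (f i)) ->
  exists2 G, in_space X G & forall i x, `|f i x| <= `|G x|.
Proof.
elim: n f => [|n IH] f sf.
  exists (fun=> 0); last by case.
  split; first exact: (borel_fun_cst x0).
  have := aq_homog (qnorm_admissible X) 0 (borel_fun_cst x0 0).
  by rewrite normr0 mul0e mulr0 => ->.
have [G sG fG] := IH _ (fun i => sf (lift ord0 i)).
exists (fun x => Num.max `|f ord0 x| `|G x|); first exact: in_space_max.
move=> i x; rewrite [leRHS]ger0_norm ?le_max ?normr_ge0 //.
by case: (unliftP ord0 i) => [j|] ->; rewrite ?fG ?lexx ?orbT.
Qed.

Definition power_sum n (f : 'I_n -> Omega -> R) (x : Omega) : R :=
  (\sum_i `|f i x| `^ r) `^ r^-1.

Lemma in_space_power_sum n (f : 'I_n -> Omega -> R) :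
  (forall i, in_space X (f i)) -> in_space X (power_sum f).
Proof.
move=> sf; have [G sG fG] := exists_common_bound sf.
have F0 x : 0 <= \sum_i `|f i x| `^ r by apply: sumr_ge0 => i _; exact: powR_ge0.
apply: (in_space_le _ _ (in_spaceZ x0 (n%:R `^ r^-1) sG)) => [|x].
  rewrite (_ : power_sum f = fun x => `|\sum_i `|f i x| `^ r| `^ r^-1).
    apply: (borel_fun_powR x0); apply: (borel_fun_sum x0) => i.
    by apply: (borel_fun_powR x0); case: (sf i).
  by apply/funext => x; rewrite ger0_norm.
rewrite normrM !(ger0_norm (powR_ge0 _ _)).
have -> : n%:R `^ r^-1 * `|G x| = (n%:R * `|G x| `^ r) `^ r^-1.
  by rewrite powRM ?powR_ge0 // -powRrM mulfV ?gt_eqF // powRr1.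
have n0 : 0 <= n%:R * `|G x| `^ r by rewrite mulr_ge0 ?powR_ge0.
rewrite ler_powR2r ?invr_gt0 // mulr_natl.
rewrite -[n in _ *+ n]card_ord -sumr_const; apply: ler_sum => i _.
by rewrite ge0_ler_powR ?nnegrE // ltW.
Qed.

Let D := (level_const s / theta) `^ (theta / (1 + theta)).
Let K := power_bound s theta.

Section Levels.
Context (n : nat) (f : 'I_n -> Omega -> R) (beta : 'I_n -> R).
Hypothesis sf : forall i, in_space X (f i).
Hypothesis beta_gt0 : forall i, 0 < beta i.
Hypothesis f_le_beta : forall i, rnorm X (f i) `^ r <= beta i.

Let Z := \sum_i beta i.
Let F x := \sum_i `|f i x| `^ r.
Hypothesis Z_gt0 : 0 < Z.

Definition in_level (i : 'I_n) (k : nat) (x : Omega) : bool :=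
  (level s theta k * beta i * F x <= Z * `|f i x| `^ r) &&
  ~~ (level s theta k.+1 * beta i * F x <= Z * `|f i x| `^ r).

Let F_ge0 x : 0 <= F x.
Proof. by apply: sumr_ge0 => i _; exact: powR_ge0. Qed.

Lemma borel_in_level i k : borel_fun (fun x => (in_level i k x)%:R : R).
Proof.
have bF : borel_fun F.
  apply: (borel_fun_sum x0) => j; apply: (borel_fun_powR x0).
  by case: (sf j).
have ble j : borel_fun (fun x =>
    (level s theta j * beta i * F x <= Z * `|f i x| `^ r)%R%:R : R).
  apply: (borel_fun_ler x0); apply: (borel_funM x0) => //.
  - exact: (borel_fun_cst x0).
  - exact: (borel_fun_cst x0).
  - by apply: (borel_fun_powR x0); case: (sf i).
have := borel_funM x0 (ble k) (borel_fun_negb x0 (ble k.+1)).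
by congr borel_fun; apply/funext => x; rewrite -natrM mulnb.
Qed.

Lemma in_level_disjoint i x k l : in_level i k x -> in_level i l x -> k = l.
Proof.
have mono a b : (a <= b)%N ->
    level s theta a * beta i * F x <= level s theta b * beta i * F x.
  move=> ab; rewrite ler_wpM2r // ler_wpM2r ?(ltW (beta_gt0 i)) //.
  rewrite /level ler_wpM2l ?(ltW (base_level_gt0 s_gt1)) //.
  by apply: ler_weXn2l => //; rewrite -expR0 ler_expR ltW.
move=> /andP[k1 k2] /andP[l1 l2]; apply/eqP; rewrite eqn_leq.
apply/andP; split; rewrite leqNgt; apply/negP => lk.
  by move/negP: l2; apply; apply: le_trans (mono _ _ lk) k1.
by move/negP: k2; apply; apply: le_trans (mono _ _ lk) l1.
Qed.

(** On the k-th level set of f_i one has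
    |f_i|^r >= z_k beta_i P^r / Z, where P is the power sum, so the pieces of
    f_i dominate multiples of the pieces of P; the lower estimate bounds the
    pieces of f_i by beta_i. *)
Lemma level_norm_sum i N :
  \sum_(k < N) (level s theta k `^ s / Z `^ s *
     rnorm X (fun x => power_sum f x * (in_level i k x)%:R) `^ p)
       `^ (1 + theta) <= 1.
Proof.
have [bfi _] := sf i.
have Q0 : 0 < 1 + theta by rewrite addr_gt0.
have bi := beta_gt0 i; have lv k := level_gt0 theta s_gt1 k.
have a0 (k : nat) : 0 <= level s theta k * beta i / Z.
  by apply: divr_ge0 (ltW Z_gt0); apply: mulr_ge0; exact: ltW.
have sP := in_space_power_sum sf.
have sPk k : in_space X (fun x => power_sum f x * (in_level i k x)%:R).
  apply: (in_space_le _ _ sP).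
    by apply: (borel_funM x0); [case: sP | exact: borel_in_level].
  move=> x; rewrite normrM ler_piMr // normr_nat lern1.
  by case: (in_level i k x).
pose g (k : 'I_N) x := f i x * (in_level i k x)%:R.
have bg k : borel_fun (g k).
  by apply: (borel_funM x0) => //; exact: borel_in_level.
have gf k x : `|g k x| <= `|f i x|.
  rewrite /g normrM ler_piMr // normr_nat lern1.
  by case: (in_level i k x).
have dg : disjoint_family g.
  move=> k l x; rewrite /g => gk gl; apply/val_inj.
  apply: (@in_level_disjoint i x).
    by apply: contraNT gk => /negbTE ->; rewrite mulr0.
  by apply: contraNT gl => /negbTE ->; rewrite mulr0.
have low := lower_rnorm x0 p_gt0 theta_gt0 lower (sf i) bg dg gf.
have gP (k : 'I_N) : (level s theta k * beta i / Z) `^ r^-1 *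
    rnorm X (fun x => power_sum f x * (in_level i k x)%:R) <= rnorm X (g k).
  have sgk : in_space X (g k) by apply: in_space_le (sf i).
  rewrite -[X in X * _]ger0_norm ?powR_ge0 // -rnormZ //.
  apply: le_rnorm sgk => [|x].
    by have [+ _] := in_spaceZ x0 ((level s theta k * beta i / Z) `^ r^-1) (sPk k).
  rewrite /g mulrA !normrM; have [/andP[kx _]|] := boolP (in_level i k x);
    last by rewrite !normr0 !mulr0.
  rewrite !normr1 !mulr1 /power_sum !(ger0_norm (powR_ge0 _ _)) -/(F x).
  rewrite -powRM //.
  have -> : `|f i x| = (`|f i x| `^ r) `^ r^-1.
    by rewrite -powRrM mulfV ?gt_eqF // powRr1.
  rewrite ler_powR2r ?invr_gt0 ?powR_ge0 //; last exact: mulr_ge0.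
  by rewrite mulrAC ler_pdivrMr // [leRHS]mulrC.
have bsQ : 0 < beta i `^ (s * (1 + theta)) by rewrite powR_gt0.
have Nk (l : nat) :
    0 <= rnorm X (fun x => power_sum f x * (in_level i l x)%:R).
  by apply: rnorm_ge0; case: (sPk l).
have pQ : 0 < p * (1 + theta) by rewrite mulr_gt0.
have sr : r^-1 * p = s by rewrite mulrC.
rewrite -(ger_pMl _ bsQ) mulr_suml.
apply: (@le_trans _ _ (rnorm X (f i) `^ (p * (1 + theta)))); last first.
  rewrite (_ : p * (1 + theta) = r * (s * (1 + theta))); last first.
    by rewrite /s mulrA [r * _]mulrC divfK ?gt_eqF.
  rewrite powRrM ler_powR2r ?powR_ge0 ?(ltW bi) //.
  by rewrite mulr_gt0.
apply: le_trans low; apply: ler_sum => k _.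
apply: le_trans (_ : _ <= ((level s theta k * beta i / Z) `^ r^-1 *
    rnorm X (fun x => power_sum f x * (in_level i k x)%:R))
      `^ (p * (1 + theta))) _; last first.
  rewrite (ler_powR2r pQ (mulr_ge0 (powR_ge0 _ _) (Nk k)) (rnorm_ge0 X (bg k))).
  exact: gP.
have u0 := Nk k; set u := rnorm X _ in u0 *.
have l0 := ltW (lv k); have b0 := ltW bi; have Zi0 := ltW Z_gt0.
have aS : (level s theta k * beta i / Z) `^ s =
    level s theta k `^ s / Z `^ s * beta i `^ s.
  rewrite (powRM _ (mulr_ge0 l0 b0)) ?invr_ge0 // (powRM _ l0 b0).
  have -> : Z^-1 `^ s = (Z `^ s)^-1.
    by rewrite -(powR_inv1 Zi0) powRAC powR_inv1 ?powR_ge0.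
  by rewrite mulrAC.
rewrite [in leRHS]powRrM (powRM p (powR_ge0 _ _) u0) -(powRrM _ r^-1 p) sr aS.
have c0 : 0 <= level s theta k `^ s / Z `^ s * u `^ p.
  by rewrite !mulr_ge0 ?invr_ge0 ?powR_ge0.
rewrite (powRrM (beta i)) -(powRM _ c0 (powR_ge0 _ _)).
by rewrite -mulrA [u `^ p * _]mulrC mulrA.
Qed.

(** The level sets, weighted by beta_i / Z times the tangent at the upper end
    of the level, cover the points where the power sum is nonzero. The cost of
    this cover is estimated level by level with holder_levels. *)
Lemma power_sum_level_bound :
  rnorm X (power_sum f) `^ p <= K * Z `^ s.
Proof.
have bZ0 i : 0 <= beta i / Z by apply: divr_ge0; exact: ltW.
have lv k := level_gt0 theta s_gt1 k.
have [N ZN] : exists N, forall i, Z < level s theta N * beta i.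
  pose b := \big[Num.min/1]_i beta i.
  have b0 : 0 < b by apply/bigmin_gtP; split.
  have [N lN] := level_unbounded s_gt1 theta_gt0 (Z / b).
  exists N => i; rewrite ltr_pdivrMr // in lN; apply: (lt_le_trans lN).
  by rewrite ler_pM2l //; exact: bigmin_le.
have cov x : power_sum f x != 0 ->
    1 <= \sum_(j : 'I_n * 'I_N)
      beta j.1 / Z * tangent s (level s theta j.2.+1) * (in_level j.1 j.2 x)%:R.
  move=> Px.
  have Fx : 0 < F x.
    rewrite lt_neqAle F_ge0 andbT eq_sym; apply: contraNN Px => /eqP Fx0.
    by rewrite /power_sum -/(F x) Fx0 powR0 // gt_eqF // invr_gt0.
  rewrite -(pair_bigA _ (fun (i : 'I_n) (k : 'I_N) => beta i / Z * tangent s (level s theta k.+1)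
    * (in_level i k x)%:R)) /=.
  apply: (@le_trans _ _ (\sum_i beta i / Z *
      (1 + s * (Z * `|f i x| `^ r / (beta i * F x) - 1)))).
    (* The affine function has value 1 at the mean of the z_i, which is 1. *)
    rewrite (eq_bigr (fun i => (1 - s) / Z * beta i + s / F x * `|f i x| `^ r)).
      rewrite big_split /= -!mulr_sumr -/Z -/(F x) !divfK ?gt_eqF //.
      by rewrite subrK.
    by move=> i _; field; rewrite !gt_eqF.
  apply: ler_sum => i _.
  under [leRHS]eq_bigr do rewrite -mulrA.
  rewrite -mulr_sumr ler_wpM2l //.
  set z := Z * _ / _.
  have zE k : (level s theta k * beta i * F x <= Z * `|f i x| `^ r) =
      (level s theta k <= z).
    by rewrite /z ler_pdivlMr ?mulr_gt0 // mulrA.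
  have [zb|bz] := leP z (base_level s).
    apply: (le_trans (tangent_base s_gt1 zb)); apply: sumr_ge0 => k _.
    by rewrite mulr_ge0 ?tangent_ge0.
  have zN : ~~ (level s theta N <= z).
    rewrite -ltNge /z ltr_pdivrMr ?mulr_gt0 // mulrA.
    apply: (@le_lt_trans _ _ (Z * F x)); last by rewrite ltr_pM2r.
    rewrite ler_pM2l // /F (bigD1 i) //= lerDl.
    by apply: sumr_ge0 => j _; exact: powR_ge0.
  have [k [kN kz zk]] : exists k, [/\ (k < N)%N, level s theta k <= z
      & ~~ (level s theta k.+1 <= z)].
    elim: N zN {ZN} => [|N IH] zN.
      by move: zN; rewrite /level expr0 mulr1 (ltW bz).
    have [zN'|zN'] := boolP (level s theta N <= z).
      by exists N; split.
    by have [k [kN ? ?]] := IH zN'; exists k; split=> //; exact: ltnW.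
  rewrite (bigD1 (Ordinal kN)) //= /in_level !zE kz zk mulr1.
  rewrite -[leLHS]addr0; apply: lerD.
    rewrite -ltNge in zk; apply: le_trans (tangent_mono s_gt1 (ltW zk)).
    by rewrite le_max lexx orbT.
  by apply: sumr_ge0 => l _; rewrite mulr_ge0 ?tangent_ge0.
have := @rnorm_cover_bound R Omega x0 X p theta p_gt0 theta_gt0 upper lower
  ('I_n * 'I_N)%type (fun j => in_level j.1 j.2)
  (fun j => beta j.1 / Z * tangent s (level s theta j.2.+1)) (power_sum f)
  (in_space_power_sum sf) (fun j => borel_in_level j.1 j.2)
  (fun j => mulr_ge0 (bZ0 j.1) (tangent_ge0 _ _)) cov.
move=> /le_trans; apply.
rewrite (_ : \sum_j _ = \sum_(i < n) \sum_(k < N)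
    beta i / Z * tangent s (level s theta k.+1) *
    rnorm X (fun x => power_sum f x * (in_level i k x)%:R) `^ p); last first.
  by rewrite pair_bigA.
rewrite (_ : K * _ = (1 + theta) ^+ 2 * (expR theta `^ s * (D * Z `^ s)));
  last by rewrite /K /power_bound -/D !mulrA.
apply: ler_wpM2l; first exact: sqr_ge0.
apply: (@le_trans _ _ (\sum_i beta i / Z * (expR theta `^ s * (D * Z `^ s))));
  last by rewrite -!mulr_suml -/Z divff ?gt_eqF // mul1r.
apply: ler_sum => i _.
under eq_bigr do rewrite -mulrA.
rewrite -mulr_sumr ler_wpM2l //.
have h := holder_levels s_gt1 theta_gt0 _ (level_norm_sum i N).
have {h} := h (fun k => mulr_ge0 (divr_ge0 (powR_ge0 _ _) (powR_ge0 _ _))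
  (powR_ge0 _ _)).
rewrite -/D => h.
have c0 : 0 <= expR theta `^ s * Z `^ s by rewrite mulr_ge0 ?powR_ge0.
apply: le_trans (_ : _ <= (expR theta `^ s * Z `^ s) * D) _; last first.
  by rewrite -mulrA [Z `^ s * D]mulrC.
apply: le_trans (ler_wpM2l c0 h); rewrite mulr_sumr; apply: ler_sum => k _.
rewrite levelS powRM ?expR_ge0 ?(ltW (lv _)) //.
rewrite le_eqVlt; apply/orP; left; apply/eqP; field.
by rewrite !gt_eqF ?powR_gt0 ?expR_gt0.
Qed.

End Levels.

Let K_gt0 : 0 < K. Proof. exact: power_bound_gt0. Qed.

(** The weights beta_i have to be positive although f_i may have norm 0, so
    each ||f_i||^r is increased by a small delta, which then tends to 0. *)
Lemma rnorm_power_sum n (f : 'I_n -> Omega -> R) :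
  (forall i, in_space X (f i)) ->
  rnorm X (power_sum f) `^ r <= K `^ s^-1 * \sum_i rnorm X (f i) `^ r.
Proof.
move=> sf; have sP := in_space_power_sum sf.
have P0 : 0 <= rnorm X (power_sum f) by apply: rnorm_ge0; case: sP.
case: n f sf sP P0 => [|n] f sf sP P0.
  rewrite big_ord0 mulr0 (_ : power_sum f = fun=> 0).
    by rewrite (rnorm0 x0) powR0 ?gt_eqF.
  apply/funext => x; rewrite /power_sum big_ord0 powR0 //.
  by rewrite invr_eq0 gt_eqF.
have Ks0 : 0 < K `^ s^-1 by exact: powR_gt0.
apply/ler_addgt0Pr => e e0.
pose delta := e / (K `^ s^-1 * n.+1%:R).
have delta0 : 0 < delta by rewrite divr_gt0 // mulr_gt0.
pose beta i := rnorm X (f i) `^ r + delta.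
have beta0 i : 0 < beta i by rewrite ltr_wpDl ?powR_ge0.
have beta_le i : rnorm X (f i) `^ r <= beta i by rewrite lerDl ltW.
have Z0 : 0 < \sum_i beta i.
  rewrite (bigD1 ord0) //= ltr_pwDl //.
  by apply: sumr_ge0 => i _; exact: ltW.
have := power_sum_level_bound sf beta0 beta_le Z0.
have Vs : 0 < s^-1 by rewrite invr_gt0.
have KZ0 : 0 <= K * (\sum_i beta i) `^ s.
  by rewrite mulr_ge0 ?powR_ge0 // ltW.
rewrite -(ler_powR2r Vs (powR_ge0 _ _) KZ0) -powRrM.
rewrite (_ : p * s^-1 = r); last by rewrite /s; field; rewrite !gt_eqF.
rewrite (powRM _ (ltW K_gt0) (powR_ge0 _ _)) -powRrM mulfV ?gt_eqF //.
rewrite powRr1 ?(ltW Z0) // => /le_trans; apply.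
rewrite big_split /= sumr_const card_ord mulrDr lerD2l -mulr_natr mulrCA.
by rewrite /delta divfK // gt_eqF // mulr_gt0.
Qed.

Lemma convexity_constant_le :
  (convexity_constant X r <= (K `^ p^-1)%:E)%E.
Proof.
apply: ereal_inf_lbound; split; first by rewrite lee_fin powR_ge0.
move=> n f sf.
have sP := in_space_power_sum sf; have := rnorm_power_sum sf.
have P0 : 0 <= rnorm X (power_sum f) by apply: rnorm_ge0; case: sP.
have S0 : 0 <= \sum_i rnorm X (f i) `^ r.
  by apply: sumr_ge0 => i _; exact: powR_ge0.
have Vr : 0 < r^-1 by rewrite invr_gt0.
have KS0 : 0 <= K `^ s^-1 * \sum_i rnorm X (f i) `^ r.
  by rewrite mulr_ge0 ?powR_ge0.
rewrite -(ler_powR2r Vr (powR_ge0 _ _) KS0) -powRrM mulfV ?gt_eqF // powRr1 //.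
rewrite (powRM _ (powR_ge0 _ _) S0) -powRrM.
rewrite (_ : s^-1 * r^-1 = p^-1); last by rewrite /s; field; rewrite !gt_eqF.
rewrite -/(power_sum f) (rnormE sP).
under [X in _ -> (_ <= _ * X `^ _)%E]eq_bigr do rewrite (rnormE (sf _)) poweR_EFin.
by rewrite sumEFin poweR_EFin -EFinM lee_fin.
Qed.

End Convexity.

(** On the empty space the weak unit would be 0 times itself and have
    norm 0. *)
Lemma function_space_inhabited (R : realType) (Omega : topologicalType)
  (X : qBanach_function_space R Omega) : exists x0 : Omega, True.
Proof.
have [u [bu _ Nu _]] := aq_weak_unit (qnorm_admissible X).
apply: contrapT => empty.
have := aq_homog (qnorm_admissible X) 0 bu.
rewrite (_ : (fun x => 0 * u x) = u).
  by rewrite normr0 mul0e => N0; rewrite N0 ltxx in Nu.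
by apply/funext => x; exfalso; apply: empty; exists x.
Qed.

Theorem theorem3p6 (R : realType) (r p : R) (hr : 0 < r) (hrp : r < p) :
  exists c : R,
    forall (Omega : topologicalType) (X : qBanach_function_space R Omega)
      (q theta : R),
      compact [set: Omega] -> hausdorff_space Omega ->
      0 < theta -> theta < 1 -> q / p = 1 + theta ->
      upper_estimate X p -> lower_estimate X q ->
      (lne (convexity_constant X r) <=
        (theta * (c + p^-1 * `|ln theta|))%:E)%E.
Proof.
exists ((2 + p / r + `|ln (level_const (p / r))|) / p).
move=> Omega X q theta _ _ t0 t1 qp upper lower.
have p0 : 0 < p := lt_trans hr hrp.
have [x0 _] := function_space_inhabited X.
have qE : q = p * (1 + theta) by rewrite -qp mulrC divfK // gt_eqF.
rewrite qE in lower.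
have Mle := convexity_constant_le x0 hr hrp t0 upper lower.
have s1 : 1 < p / r by rewrite ltr_pdivlMr // mul1r.
have := ln_power_bound s1 t0 p0; set M := _ `^ p^-1 in Mle * => lnM.
have C0 : (0 <= convexity_constant X r)%E by apply/ereal_infP => M' [].
have M0 : 0 < M by rewrite powR_gt0 ?power_bound_gt0.
apply: (@le_trans _ _ (lne M%:E)).
  by rewrite lee_lne // in_itv /= ?leey ?andbT // lee_fin ltW.
by rewrite lne_EFin // lee_fin.
Qed.
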